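(* Let $\overline{X}=X_1,\dots,X_n$ be distinct propositional variables, $Y$ a propositional variable not in $\overline{X}$, $\Phi(\overline{X},Y)$ a quantifier-free formula containing only the variables $\overline{X},Y$, and let $C_\Phi(\overline{X})$ be the regular connective $\exists Y.\,\Phi(\overline{X},Y)$. Let $\mathsf{E}Y.\,\Phi(\overline{X},Y)$ be the (existential) Pitts interpolant of $\Phi$. Then: (1) If $C_\Phi(\overline{X})$ has an auxiliary formula, then $C_\Phi(\overline{X})$ is definable in intuitionistic propositional logic. (2) Conversely, if $\mathsf{E}Y.\,\Phi(\overline{X},Y)$ is equivalent in intuitionistic propositional logic to a $\vee$-free formula and $\mathsf{E}Y.\,\Phi(\overline{X},Y)\vdash C_\Phi(\overline{X})$, then $C_\Phi(\overline{X})$ has an auxiliary formula. (3) If $C_\Phi(\overline{X})$ has some auxiliary formula, then it has a quantifier-free auxiliary formula.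
   Context: Formulas of second-order intuitionistic propositional logic are built from propositional variables and $\bot$ using $\wedge,\vee,\rightarrow$ and the propositional quantifiers $\forall X,\exists X$ (all primitive); $\neg A$ abbreviates $A\rightarrow\bot$. $\Gamma\vdash A$ denotes derivability in the standard Gentzen-style intuitionistic sequent calculus for this language (quantifiers may be instantiated by arbitrary formulas); on quantifier-free sequents it coincides with ordinary intuitionistic propositional derivability. Pitts interpolant: by a theorem of Pitts, for every quantifier-free $\Phi(\overline{X},Y)$ there is a quantifier-free formula $\mathsf{E}Y.\,\Phi(\overline{X},Y)$, unique up to intuitionistic equivalence, whose variables all belong to $\overline{X}$ and such that for every quantifier-free formula $\Psi(\overline{X})$, $\mathsf{E}Y.\,\Phi(\overline{X},Y)\vdash\Psi(\overline{X})$ if and only if $\Phi(\overline{X},Y)\vdash\Psi(\overline{X})$. The regular connective $C_\Phi(\overline{X})$ is definable in intuitionistic propositional logic if there is a quantifier-free formula $\Psi(\overline{X})$ with variables in $\overline{X}$ such that $C_\Phi(\overline{X})\vdash\Psi(\overline{X})$ and $\Psi(\overline{X})\vdash C_\Phi(\overline{X})$. A formula $\varphi$ (possibly with quantifiers) is an auxiliary formula for $C_\Phi(\overline{X})$ if $\mathsf{E}Y.\,\Phi(\overline{X},Y)\vdash\Phi(\overline{X},\varphi)$ is derivable, where $\Phi(\overline{X},\varphi)$ is $\Phi$ with $\varphi$ substituted for $Y$. *)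

(* Defs.v *)
From HB Require Import structures.
From mathcomp Require Import all_boot.

Set Implicit Arguments.
Unset Strict Implicit.
Unset Printing Implicit Defensive.

(** The syntax is pure de Bruijn with names at top level: under [d] quantifiers,
    [Var k] is bound when [k < d] and is otherwise the propositional variable
    named [k - d].  In particular the variables of a quantifier-free formula
    are exactly the names occurring in it, and alpha-equivalent formulas are
    equal. *)
Inductive form : Type :=
| Var of nat
| Bot
| And of form & form
| Or of form & form
| Imp of form & form
| All of form
| Ex of form.

Lemma form_comparable : comparable form.
Proof. move=> A B; rewrite /decidable; decide equality; decide equality. Defined.

HB.instance Definition _ := hasDecEq.Build form (compareP form_comparable).

Definition upr (r : nat -> nat) (k : nat) : nat :=
  if k is j.+1 then (r j).+1 else 0.

Fixpoint rename (r : nat -> nat) (A : form) : form :=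
  match A with
  | Var k => Var (r k)
  | Bot => Bot
  | And A B => And (rename r A) (rename r B)
  | Or A B => Or (rename r A) (rename r B)
  | Imp A B => Imp (rename r A) (rename r B)
  | All A => All (rename (upr r) A)
  | Ex A => Ex (rename (upr r) A)
  end.

Definition shift : form -> form := rename succn.

Definition ups (s : nat -> form) (k : nat) : form :=
  if k is j.+1 then shift (s j) else Var 0.

Fixpoint subst (s : nat -> form) (A : form) : form :=
  match A with
  | Var k => s k
  | Bot => Bot
  | And A B => And (subst s A) (subst s B)
  | Or A B => Or (subst s A) (subst s B)
  | Imp A B => Imp (subst s A) (subst s B)
  | All A => All (subst (ups s) A)
  | Ex A => Ex (subst (ups s) A)
  end.

(** [inst A B] replaces by [B] the variable bound by the quantifier whose body
    is [A], and removes that quantifier's level. *)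
Definition inst (A B : form) : form :=
  subst (fun k => if k is j.+1 then Var j else B) A.

Definition subst_var (Y : nat) (B A : form) : form :=
  subst (fun k => if k == Y then B else Var k) A.

(** The formula written [∃Y. A] with the named variable [Y]. *)
Definition ex_var (Y : nat) (A : form) : form :=
  Ex (rename (fun k => if k == Y then 0 else k.+1) A).

Fixpoint free_vars (A : form) : seq nat :=
  match A with
  | Var k => [:: k]
  | Bot => [::]
  | And A B | Or A B | Imp A B => free_vars A ++ free_vars B
  | All A | Ex A => [seq k.-1 | k <- free_vars A & 0 < k]
  end.

Fixpoint quantifier_free (A : form) : bool :=
  match A with
  | Var _ | Bot => true
  | And A B | Or A B | Imp A B => quantifier_free A && quantifier_free B
  | All _ | Ex _ => false
  end.

Fixpoint or_free (A : form) : bool :=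
  match A with
  | Var _ | Bot => true
  | And A B | Imp A B => or_free A && or_free B
  | Or _ _ => false
  | All A | Ex A => or_free A
  end.

Reserved Notation "G ⊢ A" (at level 70, no associativity).

(** Gentzen's LJ, with cut.  Since [⊥] is primitive, succedents are single
    formulas.  In [AllR] and [ExL] the eigenvariable is index [0], and shifting
    the side formulas is the freshness condition. *)
Inductive derivable : seq form -> form -> Prop :=
| Ax A : [:: A] ⊢ A
| BotL A : [:: Bot] ⊢ A
| Exchange G D A : perm_eq G D -> G ⊢ A -> D ⊢ A
| Weakening G A C : G ⊢ C -> A :: G ⊢ C
| Contraction G A C : A :: A :: G ⊢ C -> A :: G ⊢ C
| Cut G D A C : G ⊢ A -> A :: D ⊢ C -> G ++ D ⊢ C
| AndL1 G A B C : A :: G ⊢ C -> And A B :: G ⊢ C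
| AndL2 G A B C : B :: G ⊢ C -> And A B :: G ⊢ C
| AndR G A B : G ⊢ A -> G ⊢ B -> G ⊢ And A B
| OrL G A B C : A :: G ⊢ C -> B :: G ⊢ C -> Or A B :: G ⊢ C
| OrR1 G A B : G ⊢ A -> G ⊢ Or A B
| OrR2 G A B : G ⊢ B -> G ⊢ Or A B
| ImpL G D A B C : G ⊢ A -> B :: D ⊢ C -> Imp A B :: G ++ D ⊢ C
| ImpR G A B : A :: G ⊢ B -> G ⊢ Imp A B
| AllL G A B C : inst A B :: G ⊢ C -> All A :: G ⊢ C
| AllR G A : map shift G ⊢ A -> G ⊢ All A
| ExL G A C : A :: map shift G ⊢ shift C -> Ex A :: G ⊢ C
| ExR G A B : G ⊢ inst A B -> G ⊢ Ex A
where "G ⊢ A" := (derivable G A).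

Definition equivalent (A B : form) : Prop := [:: A] ⊢ B /\ [:: B] ⊢ A.

Definition prop_form_over (V : seq nat) (A : form) : Prop :=
  quantifier_free A /\ {subset free_vars A <= V}.

(** The interpolant [EY. Phi(X, Y)] is unique only up to [equivalent], hence a
    predicate on [E].  The variable [Y] enters only through [Psi] not
    containing it. *)
Definition pitts_interpolant (X : seq nat) (Phi E : form) : Prop :=
  prop_form_over X E /\
  forall Psi : form, prop_form_over X Psi -> ([:: E] ⊢ Psi <-> [:: Phi] ⊢ Psi).

Definition definable (X : seq nat) (C : form) : Prop :=
  exists Psi : form, prop_form_over X Psi /\ equivalent C Psi.

(** [phi] may contain quantifiers and arbitrary variables; [E] is the Pitts
    interpolant of [Phi] with respect to [Y]. *)
Definition auxiliary (Y : nat) (Phi E phi : form) : Prop :=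
  [:: E] ⊢ subst_var Y phi Phi.

(* Main.v *)
Require Import Defs.
From mathcomp Require Import all_boot.
From Stdlib Require List.
From mathcomp Require Import boolp.

Set Implicit Arguments.
Unset Strict Implicit.
Unset Printing Implicit Defensive.

(** An auxiliary formula [phi] is by definition a witness, provably from [E], of
    the quantifier in [∃Y. Phi], so [E ⊢ ∃Y. Phi]; and [∃Y. Phi ⊢ E] because
    [Phi ⊢ E] and [Y] does not occur in [E].  Hence [E] itself defines the
    connective, which is (1).

    For (2), an existential statement derived from a Harrop-like premise must
    have a witness.  This is the Aczel slash relative to [E] ([slash]).  Since
    instantiation is impredicative, slashing [∃X. A] cannot be defined from the
    instances of [A]; as in Girard's reducibility candidates, a quantifier
    ranges instead over pairs of a formula and an arbitrary proposition that
    implies its derivability from [E].  Derivability preserves the slash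
    ([slash_sound]), and a consistent [E] equivalent to a [∨]-free formula is
    slashed itself ([slash_or_free]); so [∃Y. Phi] is slashed, and this names a
    formula [B] with [E ⊢ Phi(B)].

    For (3), put [Psi := E → Phi]; the task is to replace a solution
    [⊢ Psi(phi)] by a quantifier-free one.  No elimination of the quantifiers
    of [phi] is attempted.  The finite trees labelled by sets of variables,
    ordered by passing to a subtree, form one large Kripke frame.
    Second-order derivability is sound on it when the quantifiers range over
    all upsets ([force_sound]), and on quantifier-free formulas it is complete
    ([tree_complete]).  The meaning of [phi] is thus an upset [U] of trees
    solving [Psi], possibly a very complicated one.

    It is traded for a simple one by a finite-state construction.  The type of
    a tree is the set of subformulas of [Psi] that it forces when [Y] is read
    as the given upset.  Whether a tree belongs to the new solution [V] is
    decided from its variables and the set of types of its proper subtrees: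
    one copies a decision that [U] takes somewhere in the same situation,
    except that, when a least type with the same variables is already present
    above, this type is repeated ([prescribed]).  Every type that occurs for
    [V] occurs for [U], so [V] solves [Psi] ([prescribed_solves]).  The
    repetition rule makes the type of a tree depend only on the formulas of
    implication depth at most twice the number of types ([typ_agree]).  An
    upset with this property is the meaning of a quantifier-free formula
    ([definable_upset]), and completeness turns this formula into the desired
    solution. *)

(** * Parallel substitution *)

Definition scons (T : Type) (x : T) (f : nat -> T) (k : nat) : T :=
  if k is j.+1 then f j else x.

Lemma eq_subst s s' A : s =1 s' -> subst s A = subst s' A.
Proof.
elim: A s s' => //= [A IHA B IHB|A IHA B IHB|A IHA B IHB|A IHA|A IHA] s s' ss';
  rewrite ?(IHA _ _ ss') ?(IHB _ _ ss') //;
  by rewrite (IHA _ (ups s')) // => -[|k] //=; rewrite ss'.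
Qed.

Lemma eq_rename r r' A : r =1 r' -> rename r A = rename r' A.
Proof.
elim: A r r' => //= [k|A IHA B IHB|A IHA B IHB|A IHA B IHB|A IHA|A IHA] r r' rr';
  rewrite ?rr' ?(IHA _ _ rr') ?(IHB _ _ rr') //;
  by rewrite (IHA _ (upr r')) // => -[|k] //=; rewrite rr'.
Qed.

Lemma subst_rename s r A : subst s (rename r A) = subst (s \o r) A.
Proof.
elim: A s r => //= [A IHA B IHB|A IHA B IHB|A IHA B IHB|A IHA|A IHA] s r;
  rewrite ?IHA ?IHB //; congr (_ _); by apply: eq_subst => -[].
Qed.

Lemma rename_rename r r' A : rename r (rename r' A) = rename (r \o r') A.
Proof.
elim: A r r' => //= [A IHA B IHB|A IHA B IHB|A IHA B IHB|A IHA|A IHA] r r';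
  rewrite ?IHA ?IHB //; congr (_ _); by apply: eq_rename => -[].
Qed.

Lemma rename_subst r s A : rename r (subst s A) = subst (rename r \o s) A.
Proof.
elim: A r s => //= [A IHA B IHB|A IHA B IHB|A IHA B IHB|A IHA|A IHA] r s;
  rewrite ?IHA ?IHB //; congr (_ _); apply: eq_subst => -[|k] //=;
  by rewrite /shift !rename_rename; apply: eq_rename.
Qed.

Lemma shift_subst s A : shift (subst s A) = subst (ups s) (shift A).
Proof. by rewrite /shift rename_subst subst_rename; apply: eq_subst. Qed.

Lemma subst_subst s s' A : subst s (subst s' A) = subst (subst s \o s') A.
Proof.
elim: A s s' => //= [A IHA B IHB|A IHA B IHB|A IHA B IHB|A IHA|A IHA] s s';
  rewrite ?IHA ?IHB //; congr (_ _); apply: eq_subst => -[|k] //=;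
  by rewrite shift_subst.
Qed.

Lemma subst_id s A : s =1 Var -> subst s A = A.
Proof.
elim: A s => //= [A IHA B IHB|A IHA B IHB|A IHA B IHB|A IHA|A IHA] s sV;
  rewrite ?IHA ?IHB //; by case=> [|k] //=; rewrite sV.
Qed.

Lemma inst_subst_ups s A B : inst (subst (ups s) A) B = subst (scons B s) A.
Proof.
rewrite /inst subst_subst; apply: eq_subst => -[|k] //=.
by rewrite subst_rename; apply: subst_id.
Qed.

Lemma subst_inst s A B :
  subst s (inst A B) = inst (subst (ups s) A) (subst s B).
Proof.
by rewrite inst_subst_ups /inst subst_subst; apply: eq_subst => -[].
Qed.

Lemma inst_rename_at Y A B :
  inst (rename (fun k => if k == Y then 0 else k.+1) A) B = subst_var Y B A.
Proof.
by rewrite /inst subst_rename; apply: eq_subst => k /=; case: (k == Y).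
Qed.

Lemma eq_subst_qf s s' A : quantifier_free A ->
  {in free_vars A, s =1 s'} -> subst s A = subst s' A.
Proof.
elim: A => //= [k _ ss'|A IHA B IHB|A IHA B IHB|A IHA B IHB];
  first by rewrite ss' ?inE.
all: case/andP=> qA qB ss'.
all: by rewrite IHA ?IHB // => k kA; apply: ss'; rewrite mem_cat kA ?orbT.
Qed.

(** * Structural rules *)

Section InContext.

Variables (P : form -> Prop) (A : form) (G D : seq form).

Lemma in_cons_head : {in A :: G, forall B, P B} -> P A.
Proof. by apply; rewrite mem_head. Qed.

Lemma in_cons_tail : {in A :: G, forall B, P B} -> {in G, forall B, P B}.
Proof. by move=> H B BG; apply: H; rewrite inE BG orbT. Qed.

Lemma in_cons_intro :
  P A -> {in G, forall B, P B} -> {in A :: G, forall B, P B}.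
Proof. by move=> HA HG B; rewrite inE => /orP[/eqP->|/HG]. Qed.

Lemma in_cat_left : {in G ++ D, forall B, P B} -> {in G, forall B, P B}.
Proof. by move=> H B BG; apply: H; rewrite mem_cat BG. Qed.

Lemma in_cat_right : {in G ++ D, forall B, P B} -> {in D, forall B, P B}.
Proof. by move=> H B BG; apply: H; rewrite mem_cat BG orbT. Qed.

End InContext.

Lemma derivable_mem G A : A \in G -> G ⊢ A.
Proof.
elim: G => //= B G IH; rewrite inE => /orP[/eqP ->|/IH]; last exact: Weakening.
elim: G {IH} => [|C G IH]; first exact: Ax.
apply: (@Exchange (C :: B :: G)); last exact: Weakening.
by apply/permP => p /=; rewrite addnCA.
Qed.


(** Contexts are multisets, so a premise repeating formulas of [D] is brought
    back to [D] by contractions. *)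
Lemma derivable_absorb G D A : {subset G <= D} -> G ++ D ⊢ A -> D ⊢ A.
Proof.
elim: G => //= B G IH sub H.
apply: IH => [C CG|]; first by apply: sub; rewrite inE CG orbT.
have /perm_to_rem P : B \in G ++ D by rewrite mem_cat sub ?inE ?eqxx ?orbT.
have P' : perm_eq (B :: G ++ D) (B :: B :: rem B (G ++ D)) by rewrite perm_cons.
rewrite perm_sym in P; apply: (Exchange P); apply: Contraction.
exact: Exchange H.
Qed.

Lemma derivable_sub G D A : {subset G <= D} -> G ⊢ A -> D ⊢ A.
Proof.
move=> sub H; apply: (derivable_absorb sub).
apply: (@Exchange (D ++ G)); first by rewrite perm_catC.
by elim: D {sub} => //= B D; apply: Weakening.
Qed.

Lemma derivable_mp G A B : G ⊢ Imp A B -> G ⊢ A -> G ⊢ B.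
Proof.
move=> HAB HA; have := Cut HAB (ImpL HA (Ax B)).
apply: derivable_sub => C; rewrite !mem_cat; case: (C \in G) => //=.
Qed.

(** Cutting all of [G] at once goes through implication: discharging [G] formula
    by formula leaves a context-free statement, to be applied in [D]. *)
Lemma derivable_cuts G D A : {in G, forall B, D ⊢ B} -> G ⊢ A -> D ⊢ A.
Proof.
elim: G A => [|B G IH] A DG H; first by apply: derivable_sub H.
apply: (@derivable_mp D B); last by apply: DG; rewrite inE eqxx.
by apply: IH (ImpR H) => C CG; apply: DG; rewrite inE CG orbT.
Qed.

Lemma derivable_cut1 G A B : G ⊢ A -> A :: G ⊢ B -> G ⊢ B.
Proof. by move=> HA /ImpR HAB; apply: derivable_mp HA. Qed.

Lemma map_shift_subst s G :
  map shift (map (subst s) G) = map (subst (ups s)) (map shift G).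
Proof. by rewrite -!map_comp; apply: eq_map => B /=; rewrite shift_subst. Qed.

Lemma derivable_subst s G A : G ⊢ A -> map (subst s) G ⊢ subst s A.
Proof.
move=> H; elim: H s => {G A} /=.
- by move=> A s; apply: Ax.
- by move=> A s; apply: BotL.
- by move=> G D A P _ IH s; apply: Exchange (IH s); apply: perm_map.
- by move=> G A C _ IH s; apply: Weakening.
- by move=> G A C _ IH s; apply: Contraction; apply: IH.
- by move=> G D A C _ IH1 _ IH2 s; rewrite map_cat; apply: Cut (IH1 s) (IH2 s).
- by move=> G A B C _ IH s; apply: AndL1.
- by move=> G A B C _ IH s; apply: AndL2.
- by move=> G A B _ IH1 _ IH2 s; apply: AndR.
- by move=> G A B C _ IH1 _ IH2 s; apply: OrL.
- by move=> G A B _ IH s; apply: OrR1.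
- by move=> G A B _ IH s; apply: OrR2.
- by move=> G D A B C _ IH1 _ IH2 s; rewrite map_cat; apply: ImpL.
- by move=> G A B _ IH s; apply: ImpR.
- by move=> G A B C _ IH s; apply: (@AllL _ _ (subst s B)); rewrite -subst_inst.
- by move=> G A _ IH s; apply: AllR; rewrite map_shift_subst; apply: IH.
- by move=> G A C _ IH s; apply: ExL; rewrite map_shift_subst shift_subst; apply: IH.
- by move=> G A B _ IH s; apply: (@ExR _ _ (subst s B)); rewrite -subst_inst.
Qed.

(** * The regular connective and its interpolant *)

Lemma ex_var_intro Y A B G : G ⊢ subst_var Y B A -> G ⊢ ex_var Y A.
Proof. by move=> H; apply: (@ExR _ _ B); rewrite inst_rename_at. Qed.

(** The eigenvariable condition holds because renaming [Y] to the fresh index [0]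
    and shifting the other names agree on [C]. *)
Lemma ex_var_elim Y A C : quantifier_free C -> Y \notin free_vars C ->
  [:: A] ⊢ C -> [:: ex_var Y A] ⊢ C.
Proof.
move=> qC YC.
move=> /(derivable_subst (fun k => Var (if k == Y then 0 else k.+1))) /= H.
apply: ExL => /=.
rewrite -(subst_id (rename _ A) (frefl Var)) subst_rename.
suff -> : shift C = subst (fun k => Var (if k == Y then 0 else k.+1)) C by [].
rewrite -{1}(subst_id C (frefl Var)) /shift rename_subst.
apply: eq_subst_qf => // k kC /=.
by case: eqP => // kY; rewrite -kY kC in YC.
Qed.

(** * The slash *)

Section Slash.

Variable E : form.

(** A free variable stands for a formula [s k] together with a candidate [P k],
    an arbitrary proposition used as the meaning of that formula.  The
    derivability conjuncts in the clauses of [Imp] and [All] make the slash imply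
    derivability from [E]. *)
Fixpoint slash (s : nat -> form) (P : nat -> Prop) (A : form) : Prop :=
  match A with
  | Var k => P k
  | Bot => False
  | And A B => slash s P A /\ slash s P B
  | Or A B => slash s P A \/ slash s P B
  | Imp A B => [:: E] ⊢ subst s (Imp A B) /\ (slash s P A -> slash s P B)
  | All A => [:: E] ⊢ subst s (All A) /\
      forall B (Q : Prop), (Q -> [:: E] ⊢ B) -> slash (scons B s) (scons Q P) A
  | Ex A => exists B (Q : Prop),
      (Q -> [:: E] ⊢ B) /\ slash (scons B s) (scons Q P) A
  end.

Lemma slash_rename s P r A :
  slash s P (rename r A) <-> slash (s \o r) (P \o r) A.
Proof.
elim: A s P r => //=.
- by move=> A IHA B IHB s P r; rewrite IHA IHB.
- by move=> A IHA B IHB s P r; rewrite IHA IHB.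
- by move=> A IHA B IHB s P r; rewrite IHA IHB !subst_rename.
- move=> A IH s P r; rewrite subst_rename.
  have -> : subst (ups s \o upr r) A = subst (ups (s \o r)) A.
    by apply: eq_subst => -[].
  have E1 B : scons B s \o upr r = scons B (s \o r) by apply: funext => -[].
  have E2 Q : scons Q P \o upr r = scons Q (P \o r) by apply: funext => -[].
  by split=> -[HA H]; split=> // B Q BQ; move: (H B Q BQ); rewrite IH E1 E2.
- move=> A IH s P r.
  have E1 B : scons B s \o upr r = scons B (s \o r) by apply: funext => -[].
  have E2 Q : scons Q P \o upr r = scons Q (P \o r) by apply: funext => -[].
  by split=> -[B [Q [BQ H]]]; exists B, Q; move: H; rewrite IH E1 E2.
Qed.

Lemma slash_subst s P f A :
  slash s P (subst f A) <-> slash (subst s \o f) (slash s P \o f) A.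
Proof.
have E1 B s' (f' : nat -> form) : subst (scons B s') \o ups f' = scons B (subst s' \o f').
  by apply: funext => -[|k] //=; rewrite subst_rename.
have E2 B Q s' P' (f' : nat -> form) :
    slash (scons B s') (scons Q P') \o ups f' = scons Q (slash s' P' \o f').
  by apply: funext => -[|k] //=; apply: propext; rewrite slash_rename.
elim: A s P f => //=.
- by move=> A IHA B IHB s P f; rewrite IHA IHB.
- by move=> A IHA B IHB s P f; rewrite IHA IHB.
- by move=> A IHA B IHB s P f; rewrite IHA IHB !subst_subst.
- move=> A IH s P f; rewrite subst_subst.
  have -> : subst (subst (ups s) \o ups f) A = subst (ups (subst s \o f)) A.
    by apply: eq_subst => -[|k] //=; rewrite shift_subst.
  by split=> -[HA H]; split=> // B Q BQ; move: (H B Q BQ); rewrite IH E1 E2.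
- move=> A IH s P f.
  by split=> -[B [Q [BQ H]]]; exists B, Q; move: H; rewrite IH E1 E2.
Qed.

(** Impredicative comprehension: the slash of [B] is itself a candidate for [B],
    so instantiating a quantifier stays within its range. *)
Lemma slash_inst s P A B :
  slash s P (inst A B) <-> slash (scons (subst s B) s) (scons (slash s P B) P) A.
Proof.
rewrite /inst slash_subst.
rewrite (_ : subst s \o _ = scons (subst s B) s); last by apply: funext => -[].
by rewrite (_ : slash s P \o _ = scons (slash s P B) P); last by apply: funext => -[].
Qed.

Lemma slash_shift B Q s P A :
  slash (scons B s) (scons Q P) (shift A) <-> slash s P A.
Proof. by rewrite slash_rename. Qed.

Definition admissible (s : nat -> form) (P : nat -> Prop) : Prop :=
  forall k, P k -> [:: E] ⊢ s k.

Lemma admissible_scons B (Q : Prop) s P :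
  (Q -> [:: E] ⊢ B) -> admissible s P -> admissible (scons B s) (scons Q P).
Proof. by move=> BQ sP [|k]; [exact: BQ|exact: sP]. Qed.

(** This makes the slash of a formula an admissible candidate. *)
Lemma slash_derivable s P A : admissible s P -> slash s P A -> [:: E] ⊢ subst s A.
Proof.
elim: A s P => //=.
- by move=> k s P sP /sP.
- by move=> A IHA B IHB s P sP [/(IHA _ _ sP) ? /(IHB _ _ sP) ?]; apply: AndR.
- move=> A IHA B IHB s P sP [/(IHA _ _ sP)|/(IHB _ _ sP)]; first exact: OrR1.
  exact: OrR2.
- by move=> A IHA B IHB s P sP [].
- by move=> A IHA s P sP [].
- move=> A IHA s P sP [B [Q [BQ /(IHA _ _ (admissible_scons BQ sP)) H]]].
  by apply: (@ExR _ _ B); rewrite inst_subst_ups.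
Qed.

Theorem slash_sound G A : G ⊢ A -> forall s P, admissible s P ->
  {in G, forall B, slash s P B} -> slash s P A.
Proof.
have push s P G' B : admissible s P -> {in G', forall B, slash s P B} ->
    G' ⊢ B -> [:: E] ⊢ subst s B.
  move=> sP HG /(derivable_subst s); apply: derivable_cuts => _ /mapP[C CG ->].
  exact: slash_derivable (HG _ CG).
have shifted s P B Q G' : {in G', forall B, slash s P B} ->
    {in map shift G', forall C, slash (scons B s) (scons Q P) C}.
  by move=> H _ /mapP[C CG ->]; apply/slash_shift/H.
elim=> {G A}.
- by move=> A s P sP /in_cons_head.
- by move=> A s P sP /in_cons_head.
- by move=> G D A GD _ IH s P sP H; apply: IH => // B; rewrite (perm_mem GD); apply: H.
- by move=> G A C _ IH s P sP /in_cons_tail; apply: IH.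
- by move=> G A C _ IH s P sP H; apply: IH => //; apply: in_cons_intro (in_cons_head H) H.
- move=> G D A C _ IH1 _ IH2 s P sP H; apply: IH2 => //; apply: in_cons_intro (in_cat_right H).
  by apply: IH1 => //; apply: in_cat_left H.
- move=> G A B C _ IH s P sP H; apply: IH => //; apply: in_cons_intro (in_cons_tail H).
  by case: (in_cons_head H).
- move=> G A B C _ IH s P sP H; apply: IH => //; apply: in_cons_intro (in_cons_tail H).
  by case: (in_cons_head H).
- by move=> G A B _ IH1 _ IH2 s P sP H; split; [apply: IH1|apply: IH2].
- move=> G A B C _ IH1 _ IH2 s P sP H; have HG := in_cons_tail H.
  by case: (in_cons_head H) => ?; [apply: IH1 => //|apply: IH2 => //]; apply: in_cons_intro.
- by move=> G A B _ IH s P sP H; left; apply: IH.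
- by move=> G A B _ IH s P sP H; right; apply: IH.
- move=> G D A B C _ IH1 _ IH2 s P sP H; have HGD := in_cons_tail H.
  apply: IH2 => //; apply: in_cons_intro (in_cat_right HGD).
  by case: (in_cons_head H) => _; apply; apply: IH1 => //; apply: in_cat_left HGD.
- move=> G A B D IH s P sP H; split; first exact: push sP H (ImpR D).
  by move=> HA; apply: IH => //; apply: in_cons_intro.
- move=> G A B C _ IH s P sP H; apply: IH => //; apply: in_cons_intro (in_cons_tail H).
  apply/slash_inst; case: (in_cons_head H) => _; apply; exact: slash_derivable.
- move=> G A D IH s P sP H; split; first exact: push sP H (AllR D).
  move=> B Q BQ; apply: IH; first exact: admissible_scons.
  exact: shifted.
- move=> G A C _ IH s P sP H; case: (in_cons_head H) => B [Q [BQ HA]].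
  apply/(slash_shift B Q); apply: IH; first exact: admissible_scons.
  by apply: in_cons_intro => //; apply: shifted (in_cons_tail H).
- move=> G A B _ IH s P sP H; exists (subst s B), (slash s P B); split.
    exact: slash_derivable.
  by apply/slash_inst; apply: IH.
Qed.

End Slash.

(** Without disjunction, slash and derivability from [E] agree once they agree on
    variables: in the clause for [Imp] the hypothesis of the slash is turned into
    a derivability, to which the implication applies. *)
Lemma slash_or_free E D : ~ [:: E] ⊢ Bot -> quantifier_free D -> or_free D ->
  [:: E] ⊢ D <-> slash E Var (fun k => [:: E] ⊢ Var k) D.
Proof.
move=> consE qD oD; split; last first.
  by move=> /slash_derivable; rewrite subst_id //; apply.
elim: D qD oD => //= [A IHA B IHB|A IHA B IHB].
  move=> /andP[qA qB] /andP[oA oB] H; split.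
    by apply: IHA => //; apply: derivable_cut1 H _; apply: AndL1;
      apply: derivable_mem; apply: mem_head.
  by apply: IHB => //; apply: derivable_cut1 H _; apply: AndL2;
      apply: derivable_mem; apply: mem_head.
move=> /andP[qA qB] /andP[oA oB] H; split; first by rewrite !subst_id.
move=> /slash_derivable; rewrite subst_id // => HA.
by apply: IHB => //; apply: derivable_mp H _; apply: HA.
Qed.

Theorem or_free_witness Y Phi E D : quantifier_free D -> or_free D ->
  equivalent E D -> [:: E] ⊢ ex_var Y Phi ->
  exists phi, auxiliary Y Phi E phi.
Proof.
move=> qD oD [ED DE] H.
(* The slash of [⊥] is empty, so an inconsistent [E] is treated apart. *)
have [bot|consE] := lem ([:: E] ⊢ Bot).
  exists Bot; apply: derivable_cut1 bot _; apply: derivable_sub (BotL _) => B.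
  by rewrite !inE => ->.
have adm : admissible E Var (fun k => [:: E] ⊢ Var k) by [].
have slashE : slash E Var (fun k => [:: E] ⊢ Var k) E.
  apply: (slash_sound DE) => // B; rewrite inE => /eqP ->.
  exact/slash_or_free.
have [|B [Q [BQ]]] := slash_sound H adm; first by move=> B; rewrite inE => /eqP ->.
move=> /(slash_derivable (admissible_scons BQ adm)) HB; exists B; move: HB.
by rewrite -inst_subst_ups subst_id ?inst_rename_at // => -[].
Qed.

(** * Kripke semantics of the quantifiers *)

Section Kripke.

Variables (W : Type) (le : W -> W -> Prop).
Hypothesis le_refl : forall w, le w w.
Hypothesis le_trans : forall w1 w2 w3, le w1 w2 -> le w2 w3 -> le w1 w3.

Definition upset (U : W -> Prop) : Prop := forall w w', le w w' -> U w -> U w'.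

(** Since [upset] does not depend on the world, quantifiers have a constant
    domain and persistence requires no inspection of later worlds. *)
Fixpoint force (e : nat -> W -> Prop) (A : form) (w : W) : Prop :=
  match A with
  | Var k => e k w
  | Bot => False
  | And A B => force e A w /\ force e B w
  | Or A B => force e A w \/ force e B w
  | Imp A B => forall w', le w w' -> force e A w' -> force e B w'
  | All A => forall U, upset U -> force (scons U e) A w
  | Ex A => exists U, upset U /\ force (scons U e) A w
  end.

Lemma upset_scons U e :
  upset U -> (forall k, upset (e k)) -> forall k, upset (scons U e k).
Proof. by move=> uU ue [|k]; [exact: uU|exact: ue]. Qed.

Lemma upset_force e A : (forall k, upset (e k)) -> upset (force e A).
Proof.
elim: A e => //=.
- by move=> e ue w w' _ [].
- by move=> A IHA B IHB e ue w w' ww' [/(IHA _ ue _ _ ww') ? /(IHB _ ue _ _ ww')].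
- by move=> A IHA B IHB e ue w w' ww' [/(IHA _ ue _ _ ww')|/(IHB _ ue _ _ ww')];
    [left|right].
- by move=> A IHA B IHB e ue w w' ww' H w'' /(le_trans ww'); apply: H.
- move=> A IH e ue w w' ww' H U uU; apply: IH ww' _; last exact: H.
  exact: upset_scons.
- move=> A IH e ue w w' ww' [U [uU H]]; exists U; split=> //; apply: IH ww' H.
  exact: upset_scons.
Qed.

Lemma force_rename e r A : force e (rename r A) = force (e \o r) A.
Proof.
have E1 U (e' : nat -> W -> Prop) r' : scons U e' \o upr r' = scons U (e' \o r').
  by apply: funext => -[].
elim: A e r => //=.
- by move=> A IHA B IHB e r; rewrite IHA IHB.
- by move=> A IHA B IHB e r; rewrite IHA IHB.
- by move=> A IHA B IHB e r; rewrite IHA IHB.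
- move=> A IH e r; apply: funext => w; apply: propext.
  by split=> H U uU; move: (H U uU); rewrite IH E1.
- move=> A IH e r; apply: funext => w; apply: propext.
  by split=> -[U [uU H]]; exists U; move: H; rewrite IH E1.
Qed.

Lemma force_subst e s A : force e (subst s A) = force (force e \o s) A.
Proof.
have E1 U e' s' : force (scons U e') \o ups s' = scons U (force e' \o s').
  by apply: funext => -[|k] //=; rewrite force_rename.
elim: A e s => //=.
- by move=> A IHA B IHB e r; rewrite IHA IHB.
- by move=> A IHA B IHB e r; rewrite IHA IHB.
- by move=> A IHA B IHB e r; rewrite IHA IHB.
- move=> A IH e r; apply: funext => w; apply: propext.
  by split=> H U uU; move: (H U uU); rewrite IH E1.
- move=> A IH e r; apply: funext => w; apply: propext.
  by split=> -[U [uU H]]; exists U; move: H; rewrite IH E1.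
Qed.

(** Comprehension: the meaning of any formula is an upset, hence in the range of
    the quantifiers. *)
Lemma force_inst e A B : force e (inst A B) = force (scons (force e B) e) A.
Proof. by rewrite /inst force_subst; congr force; apply: funext => -[]. Qed.

Theorem force_sound G A : G ⊢ A -> forall e, (forall k, upset (e k)) ->
  forall w, {in G, forall B, force e B w} -> force e A w.
Proof.
have shifted e w U G' : {in G', forall B, force e B w} ->
    {in map shift G', forall C, force (scons U e) C w}.
  by move=> H _ /mapP[C CG ->]; rewrite force_rename; apply: H.
elim=> {G A}.
- by move=> A e ue w /in_cons_head.
- by move=> A e ue w /in_cons_head.
- by move=> G D A GD _ IH e ue w H; apply: IH => // B; rewrite (perm_mem GD); apply: H.
- by move=> G A C _ IH e ue w /in_cons_tail; apply: IH.
- by move=> G A C _ IH e ue w H; apply: IH => //; apply: in_cons_intro (in_cons_head H) H.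
- move=> G D A C _ IH1 _ IH2 e ue w H; apply: IH2 => //; apply: in_cons_intro (in_cat_right H).
  by apply: IH1 => //; apply: in_cat_left H.
- move=> G A B C _ IH e ue w H; apply: IH => //; apply: in_cons_intro (in_cons_tail H).
  by case: (in_cons_head H).
- move=> G A B C _ IH e ue w H; apply: IH => //; apply: in_cons_intro (in_cons_tail H).
  by case: (in_cons_head H).
- by move=> G A B _ IH1 _ IH2 e ue w H; split; [apply: IH1|apply: IH2].
- move=> G A B C _ IH1 _ IH2 e ue w H; have HG := in_cons_tail H.
  by case: (in_cons_head H) => ?; [apply: IH1 => //|apply: IH2 => //]; apply: in_cons_intro.
- by move=> G A B _ IH e ue w H; left; apply: IH.
- by move=> G A B _ IH e ue w H; right; apply: IH.
- move=> G D A B C _ IH1 _ IH2 e ue w H; have HGD := in_cons_tail H.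
  apply: IH2 => //; apply: in_cons_intro (in_cat_right HGD).
  apply: (in_cons_head H) (le_refl w) _; apply: IH1 => //; apply: in_cat_left HGD.
- move=> G A B _ IH e ue w H w' ww' HA; apply: IH => //; apply: in_cons_intro => // C CG.
  exact: upset_force ww' (H C CG).
- move=> G A B C _ IH e ue w H; apply: IH => //; apply: in_cons_intro (in_cons_tail H).
  by rewrite force_inst; apply: (in_cons_head H); apply: upset_force.
- move=> G A _ IH e ue w H U uU; apply: IH; first exact: upset_scons.
  exact: shifted.
- move=> G A C _ IH e ue w H; case: (in_cons_head H) => U [uU HA].
  suff : force (scons U e) (shift C) w by rewrite force_rename.
  apply: IH; first exact: upset_scons.
  by apply: in_cons_intro => //; apply: shifted (in_cons_tail H).
- move=> G A B _ IH e ue w H; exists (force e B); split; first exact: upset_force.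
  by rewrite -force_inst; apply: IH.
Qed.

End Kripke.

(** * Finite trees *)

Inductive tree : Type := Node of seq nat & seq tree.

(** The generated induction principle ignores the nested occurrence of [tree]. *)
Lemma tree_ind_in (P : tree -> Prop) :
  (forall v cs, (forall c, List.In c cs -> P c) -> P (Node v cs)) ->
  forall K, P K.
Proof.
move=> H; fix IH 1 => -[v cs]; apply: H.
elim: cs => [|c cs IHcs] d; first by case.
by case=> [<-|dcs]; [apply: (IH c)|apply: (IHcs d dcs)].
Qed.

Inductive reach : tree -> tree -> Prop :=
| reach_refl K : reach K K
| reach_child v cs c K : List.In c cs -> reach c K -> reach (Node v cs) K.

Lemma reach_trans K1 K2 K3 : reach K1 K2 -> reach K2 K3 -> reach K1 K3.
Proof.
by move=> H; elim: H K3 => // v cs c K ccs _ IH K3 /IH; apply: reach_child.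
Qed.

Lemma reach_Node v cs K :
  reach (Node v cs) K <-> K = Node v cs \/ exists2 c, List.In c cs & reach c K.
Proof.
split=> [H|[->|[c]]]; [|exact: reach_refl|exact: reach_child].
by inversion H; [left|right; exists c].
Qed.

(** Trees are finite, so going up from a node with [P] ends at one with no [P]
    strictly above. *)
Lemma topmost (P : tree -> Prop) K K1 : reach K K1 -> P K1 -> exists v cs,
  [/\ reach K (Node v cs), P (Node v cs)
    & forall c K', List.In c cs -> reach c K' -> ~ P K'].
Proof.
elim/tree_ind_in: K K1 => v cs IH K1 KK1 PK1.
have [[c [K' [ccs cK' PK']]]|H] :=
  lem (exists c K', [/\ List.In c cs, reach c K' & P K']).
  have [v' [cs' [cK'' PK'' top]]] := IH c ccs K' cK' PK'.
  by exists v', cs'; split=> //; apply: reach_child cK''.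
exists v, cs; split; first exact: reach_refl.
  move: KK1 PK1 => /reach_Node[-> //|[c ccs cK1] PK1].
  by case: H; exists c, K1.
by move=> c K' ccs cK' PK'; apply: H; exists c, K'.
Qed.

Definition label (K : tree) : seq nat := let: Node v _ := K in v.

(** Labels need not grow along the order: truth of a variable is taken to be
    membership in all labels from here on, which is automatically an upset. *)
Definition holds_var (x : nat) (K : tree) : Prop :=
  forall K', reach K K' -> x \in label K'.

Lemma upset_holds_var x : upset reach (holds_var x).
Proof. by move=> K K' KK' H K'' /(reach_trans KK'); apply: H. Qed.

Lemma holds_var_Node x v cs : holds_var x (Node v cs) <->
  x \in v /\ forall c, List.In c cs -> holds_var x c.
Proof.
split=> [H|[xv H] K /reach_Node[->//|[c ccs cK]]]; last exact: H cK.
split=> [|c ccs K cK]; first exact: (H _ (reach_refl _)).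
by apply: H; apply: reach_child cK.
Qed.

Notation tforce := (force reach holds_var).

Lemma upset_tforce A : upset reach (tforce A).
Proof. by apply: upset_force => [|x]; [exact: reach_trans|exact: upset_holds_var]. Qed.

(** * Completeness *)

Fixpoint subforms (A : form) : seq form :=
  A :: match A with
       | And A B | Or A B | Imp A B => subforms A ++ subforms B
       | All A | Ex A => subforms A
       | _ => [::]
       end.

Lemma subforms_refl A : A \in subforms A.
Proof. by case: A => *; rewrite inE eqxx. Qed.

Lemma subforms_trans A B C :
  A \in subforms B -> B \in subforms C -> A \in subforms C.
Proof.
move=> AB; have E C' : B = C' -> A \in subforms C' by move=> <-.
elim: C => /= [k||C IHC D IHD|C IHC D IHD|C IHC D IHD|C IH|C IH].
1-2: by rewrite inE => /eqP /E.
1-3: rewrite inE mem_cat => /orP[/eqP /E //|/orP[/IHC|/IHD] H];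
  by rewrite inE mem_cat H !orbT.
1-2: by rewrite inE => /orP[/eqP /E //|/IH H]; rewrite inE H orbT.
Qed.

Lemma subforms_args A B C :
  [|| And A B \in subforms C, Or A B \in subforms C | Imp A B \in subforms C] ->
  A \in subforms C /\ B \in subforms C.
Proof.
by case/or3P => H; split; apply: subforms_trans H;
  rewrite /= inE mem_cat subforms_refl !orbT.
Qed.

Lemma subforms_qf A B : A \in subforms B -> quantifier_free B -> quantifier_free A.
Proof.
elim: B => //= [k||B IHB C IHC|B IHB C IHC|B IHB C IHC].
1-2: by rewrite inE => /eqP ->.
all: rewrite inE mem_cat => /orP[/eqP -> //|/orP[/IHB|/IHC] H] /andP[]; auto.
Qed.

Lemma subforms_var x A : quantifier_free A ->
  (Var x \in subforms A) = (x \in free_vars A).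
Proof.
elim: A => //= [k _|A IHA B IHB|A IHA B IHB|A IHA B IHB]; 
  first by rewrite !inE; apply/eqP/eqP => [[]|->].
all: by case/andP=> /IHA EA /IHB EB; rewrite inE /= !mem_cat EA EB.
Qed.

(** Finite choice: the children needed for the formulas of a list are gathered in
    one list. *)
Lemma collect_trees (R : tree -> Prop) (Q : form -> tree -> Prop) (S : seq form) :
  {in S, forall B, exists2 K, R K & Q B K} ->
  exists2 cs, (forall c, List.In c cs -> R c)
    & {in S, forall B, exists2 c, List.In c cs & Q B c}.
Proof.
elim: S => [_|B S IH H]; first by exists [::].
have [K RK QK] := H B (mem_head _ _).
have [|cs Rcs Qcs] := IH; first by move=> C CS; apply: H; rewrite inE CS orbT.
exists (K :: cs) => [c /= [<-|]//|]; first exact: Rcs.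
move=> C; rewrite inE => /orP[/eqP ->|/Qcs[c ccs Qc]]; first by exists K; [left|].
by exists c; [right|].
Qed.

Section Completeness.

Variable A0 : form.
Hypothesis qA0 : quantifier_free A0.
Let S := subforms A0.

(** Induction on the number of formulas of [S] missing from [G].  If some missing
    formula can be added without deriving [C], add it.  Otherwise [G] is
    maximal, hence closed under derivability and prime, and it is realised at a
    root whose children refute the implications missing from [G]; these children
    force strictly more formulas, so they are given by induction. *)
Lemma countermodel n G C : count [predC G] S <= n -> {subset G <= S} -> C \in S ->
  ~ G ⊢ C -> exists2 K, {in G, forall B, tforce B K} & ~ tforce C K.
Proof.
elim: n G C => [|n IH] G C.
  rewrite leqn0 => /eqP E0 GS CS; case; apply: derivable_mem.
  apply: contraT => CG; suff : 0 < count [predC G] S by rewrite E0.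
  by rewrite -has_count; apply/hasP; exists C.
move=> cnt GS CS GC.
have smaller B : B \in S -> B \notin G -> count [predC B :: G] S <= n.
  move=> BS BG; rewrite -ltnS; apply: leq_trans cnt.
  have -> : count [predC G] S = count [predC B :: G] S + count_mem B S.
    elim: S {BS} => //= D T IHT; rewrite IHT; rewrite !inE negb_or addnACA.
    congr (_ + _); case: eqP => [->|_] /=; last by rewrite addn0.
    by rewrite BG.
  by rewrite -addn1 leq_add2l -has_count has_pred1.
have subS B : B \in S -> {subset B :: G <= S}.
  by move=> BS D; rewrite inE => /orP[/eqP ->|/GS].
(* Either [G] can be extended, or it is maximal among the subsets of [S] that do
   not derive [C]. *)
have [[B [BS BG BGC]]|max] := lem (exists B, [/\ B \in S, B \notin G & ~ B :: G ⊢ C]).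
  have [K HK CK] := IH _ _ (smaller B BS BG) (subS B BS) CS BGC.
  by exists K => // D DG; apply: HK; rewrite inE DG orbT.
have {}max B : B \in S -> B \notin G -> B :: G ⊢ C.
  by move=> BS BG; apply: contrapT => H; apply: max; exists B.
have closed B : B \in S -> G ⊢ B -> B \in G.
  move=> BS GB; apply: contraT => BG; case: GC.
  exact: derivable_cut1 GB (max B BS BG).
(* The missing implications not already refuted at the root. *)
pose imps := [seq B <- S | if B is Imp B1 B2 then (B \notin G) && (B1 \notin G) else false].
have [|cs csG csI] := @collect_trees (fun K => {in G, forall B, tforce B K})
   (fun B K => if B is Imp B1 B2 then tforce B1 K /\ ~ tforce B2 K else False) imps.
  move=> B; rewrite mem_filter; case: B => // B1 B2 /andP[/andP[BG B1G] BS].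
  have [B1S B2S] : B1 \in S /\ B2 \in S by apply: subforms_args; rewrite BS ?orbT.
  have [|K KG KB2] := IH _ _ (smaller B1 B1S B1G) (subS B1 B1S) B2S.
    by move=> /ImpR /(closed _ BS); rewrite (negPf BG).
  exists K; first by move=> D DG; apply: KG; rewrite inE DG orbT.
  by split=> //; apply: KG; rewrite inE eqxx.
pose K := Node [seq k <- free_vars A0 | Var k \in G] cs.
have truth B : B \in S -> tforce B K <-> B \in G.
  elim: B => [k||B1 IH1 B2 IH2|B1 IH1 B2 IH2|B1 IH1 B2 IH2|B1 _|B1 _] BS /=.
  - rewrite holds_var_Node mem_filter -subforms_var // BS andbT.
    split=> [[]//|kG]; split=> // c /csG H; exact: H _ kG.
  - split=> // BG; case: GC; apply: derivable_sub (BotL C) => D.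
    by rewrite inE => /eqP ->.
  - have [B1S B2S] : B1 \in S /\ B2 \in S by apply: subforms_args; rewrite BS ?orbT.
    rewrite IH1 // IH2 //; split=> [[H1 H2]|BG].
      by apply: closed => //; apply: AndR; apply: derivable_mem.
    have GB : G ⊢ And B1 B2 by apply: derivable_mem.
    split; apply: closed => //; apply: derivable_cut1 GB _.
      by apply: AndL1; apply: derivable_mem; apply: mem_head.
    by apply: AndL2; apply: derivable_mem; apply: mem_head.
  - have [B1S B2S] : B1 \in S /\ B2 \in S by apply: subforms_args; rewrite BS ?orbT.
    rewrite IH1 // IH2 //; split=> [[H|H]|BG].
    + by apply: closed => //; apply: OrR1; apply: derivable_mem.
    + by apply: closed => //; apply: OrR2; apply: derivable_mem.
    apply: contrapT => /not_orP[/negP H1 /negP H2]; case: GC.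
    have := OrL (max B1 B1S H1) (max B2 B2S H2).
    by apply: derivable_sub => D; rewrite inE => /orP[/eqP ->|].
  - have [B1S B2S] : B1 \in S /\ B2 \in S by apply: subforms_args; rewrite BS ?orbT.
    split=> [H|BG].
      apply: contraT => BG.
      have B1G : B1 \notin G.
        apply/negP => B1G; move/negP: BG; apply; apply: closed => //; apply: ImpR.
        apply: Weakening; apply: derivable_mem; apply/IH2 => //.
        by apply: H; [exact: reach_refl|apply/IH1].
      have [|c ccs [cB1]] := csI (Imp B1 B2); first by rewrite mem_filter BG B1G.
      by case; apply: H => //; apply: reach_child ccs (reach_refl c).
    move=> K' /reach_Node[-> /IH1 B1G|[c ccs cK']].
      apply/IH2 => //; apply: closed => //.
      by apply: (@derivable_mp _ B1); apply: derivable_mem => //; apply: B1G.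
    exact: (csG c ccs _ BG).
  - by have := subforms_qf BS qA0.
  - by have := subforms_qf BS qA0.
exists K => [B BG|/truth H]; first by apply/truth => //; apply: GS.
by apply: GC; apply: derivable_mem; apply: H.
Qed.

End Completeness.

Theorem tree_complete A : quantifier_free A -> (forall K, tforce A K) -> [::] ⊢ A.
Proof.
move=> qA H; apply: contrapT => nA.
have [//|K _] := countermodel qA (leqnn _) _ (subforms_refl A) nA.
by case; apply: H.
Qed.

(** * Definability by formulas of bounded depth *)

Definition conj (Q : seq form) : form := foldr And (Imp Bot Bot) Q.
Definition disj (Q : seq form) : form := foldr Or Bot Q.

Lemma force_conj Q K : tforce (conj Q) K <-> {in Q, forall A, tforce A K}.
Proof.
elim: Q => [|A Q IH] /=; first by split.
rewrite IH; split=> [[HA HS] B|H]; first by rewrite inE => /orP[/eqP ->|/HS].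
by split=> [|B BS]; apply: H; rewrite inE ?eqxx ?BS ?orbT.
Qed.

Lemma force_disj Q K : tforce (disj Q) K <-> exists2 A, A \in Q & tforce A K.
Proof.
elim: Q => [|A Q IH] /=; first by split=> // -[].
rewrite IH; split=> [[HA|[B BS HB]]|[B]].
- by exists A; rewrite ?inE ?eqxx.
- by exists B; rewrite ?inE ?BS ?orbT.
- by rewrite inE => /orP[/eqP ->|BS HB]; [left|right; exists B].
Qed.

Lemma quantifier_free_conj Q :
  {in Q, forall A, quantifier_free A} -> quantifier_free (conj Q).
Proof.
elim: Q => //= A Q IH H; rewrite H ?mem_head //=; apply: IH => B BS.
by apply: H; rewrite inE BS orbT.
Qed.

Lemma quantifier_free_disj Q :
  {in Q, forall A, quantifier_free A} -> quantifier_free (disj Q).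
Proof.
elim: Q => //= A Q IH H; rewrite H ?mem_head //=; apply: IH => B BS.
by apply: H; rewrite inE BS orbT.
Qed.

Definition sublists (L : seq form) : seq (seq form) :=
  [seq mask m L | m : (size L).-tuple bool].

Lemma filter_sublists p L : filter p L \in sublists L.
Proof. by apply/imageP; exists (map_tuple p (in_tuple L)); rewrite //= filter_mask. Qed.

Lemma sublists_sub Q L : Q \in sublists L -> {subset Q <= L}.
Proof. by move=> /imageP[m _ ->] A /mem_mask. Qed.

Section Depth.

Variable X : seq nat.

(** Up to equivalence, all formulas over [X] of implication depth at most [N] are
    disjunctions of conjunctions of these; [⊤] and [⊥] arise as the empty
    conjunction and disjunction. *)
Fixpoint forms_upto (N : nat) : seq form :=
  if N is M.+1 then
    forms_upto M ++ [seq Imp (conj Q) (disj T) | Q <- sublists (forms_upto M),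
                                                  T <- sublists (forms_upto M)]
  else [seq Var x | x <- X].

Lemma forms_upto_qf N : {in forms_upto N, forall A, quantifier_free A}.
Proof.
elim: N => [|N IH] A /=; first by case/mapP=> x _ ->.
rewrite mem_cat => /orP[/IH //|/allpairsP[[Q T] /= [SL TL ->]]] /=.
apply/andP; split; [apply: quantifier_free_conj|apply: quantifier_free_disj] => B.
  by move/(sublists_sub SL)/IH.
by move/(sublists_sub TL)/IH.
Qed.

Definition agree N K K' : Prop := {in forms_upto N, forall A, tforce A K <-> tforce A K'}.

Lemma agree_sym N K K' : agree N K K' -> agree N K' K.
Proof. by move=> H A AN; rewrite H. Qed.

Lemma agree_pred N K K' : agree N.+1 K K' -> agree N K K'.
Proof. by move=> H A AN; apply: H; rewrite /= mem_cat AN. Qed.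

Lemma agree_var N K K' x : agree N K K' -> x \in X -> holds_var x K <-> holds_var x K'.
Proof.
elim: N => [|N IH] H xX; last exact: IH (agree_pred H) xX.
by apply: (H (Var x)); apply: map_f.
Qed.

(** Bounded simulation.  If the [N]-formulas true at [K1'] are [Q] and the others
    are [T], then [K1'] refutes [conj Q → disj T]; so does [K'], hence [K], and
    the world above [K] witnessing this agrees with [K1']. *)
Lemma match_above N K K' K1' :
  (forall A, A \in forms_upto N.+1 -> tforce A K -> tforce A K') ->
  reach K' K1' -> exists2 K1, reach K K1 & agree N K1 K1'.
Proof.
move=> H KK1'; pose p A := `[< tforce A K1' >].
have [//|no] := lem (exists2 K1, reach K K1 & agree N K1 K1').
pose Q := [seq A <- forms_upto N | p A]; pose T := [seq A <- forms_upto N | ~~ p A].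
have SS' : Imp (conj Q) (disj T) \in forms_upto N.+1.
  rewrite /= mem_cat; apply/orP; right; apply/allpairsP; exists (Q, T).
  by split; rewrite ?filter_sublists.
have /(H _ SS')/(_ _ KK1') : tforce (Imp (conj Q) (disj T)) K.
  move=> K1 KK1 /force_conj HS; apply/force_disj; apply: contrapT => HS'.
  case: no; exists K1 => // A AN; case pA : (p A).
    by split=> _; [apply/asboolP|apply: HS; rewrite mem_filter pA].
  split=> [HA|]; last by move/asboolP; rewrite [`[< _ >]]pA.
  by case: HS'; exists A => //; rewrite mem_filter pA.
have /force_conj HS : {in Q, forall A, tforce A K1'}.
  by move=> A; rewrite mem_filter => /andP[/asboolP].
move=> /(_ HS) /force_disj[A].
by rewrite mem_filter => /andP[/asboolPn].
Qed.

Lemma match_above_agree N K K' K1 :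
  agree N.+1 K K' -> reach K K1 -> exists2 K1', reach K' K1' & agree N K1 K1'.
Proof.
move=> H KK1; have [|K1' K'K1' H'] := @match_above N K' K K1 _ KK1.
  by move=> A AN; apply: (H A AN).2.
by exists K1'; [|apply: agree_sym].
Qed.

(** The defining formula is the disjunction, over the members of [U], of the
    conjunction of the formulas of depth [N + 1] that they force.  The extra level
    is what makes this sound: a world forcing at least as much as a member [K0]
    need not agree with [K0], but by bounded simulation it agrees at depth [N]
    with a world above [K0], which is in [U]. *)
Theorem definable_upset N (U : tree -> Prop) : upset reach U ->
  (forall K K', agree N K K' -> U K -> U K') ->
  exists2 A, quantifier_free A & forall K, tforce A K <-> U K.
Proof.
move=> uU invU.
pose th K := [seq A <- forms_upto N.+1 | `[< tforce A K >]].
pose D := [seq conj Q | Q <- sublists (forms_upto N.+1)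
                      & `[< exists2 K, U K & Q = th K >]].
exists (disj D) => [|K].
  apply: quantifier_free_disj => _ /mapP[Q + ->].
  rewrite mem_filter => /andP[_ /sublists_sub SL].
  by apply: quantifier_free_conj => A /SL; apply: forms_upto_qf.
split=> [/force_disj[_ /mapP[Q + ->]]|UK].
  rewrite mem_filter => /andP[/asboolP[K0 UK0 ->] _] /force_conj HS.
  have [|K1 K0K1 /invU] := @match_above N K0 K K _ (reach_refl K).
    by move=> A AN HA; apply: HS; rewrite mem_filter AN andbT; apply/asboolP.
  by apply; apply: uU K0K1 UK0.
apply/force_disj; exists (conj (th K)).
  apply: map_f; rewrite mem_filter filter_sublists andbT.
  by apply/asboolP; exists K.
by apply/force_conj => A; rewrite mem_filter => /andP[/asboolP].
Qed.

End Depth.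

(** * Replacing a solution by a finite-state one *)

Definition inside (K' K : tree) : Prop :=
  let: Node v cs := K in exists2 c, List.In c cs & reach c K'.

(** Definition of a set of trees by recursion on subtrees, for a functional that
    looks at its argument only on proper subtrees. *)
Lemma tree_recursion (F : tree -> (tree -> Prop) -> Prop) :
  (forall K V V', (forall K', inside K' K -> V K' <-> V' K') -> F K V -> F K V') ->
  exists V : tree -> Prop, forall K, V K <-> F K V.
Proof.
move=> locF.
have wf : well_founded inside.
  suff acc K : forall K', reach K K' -> Acc inside K'.
    by move=> K; apply: (acc K); apply: reach_refl.
  elim/tree_ind_in: K => v cs IH K' /reach_Node[->|[c ccs]]; last exact: IH.
  by constructor=> K'' [c ccs]; apply: IH.
pose G K (rec : forall K', inside K' K -> Prop) :=
  F K (fun K' => exists h : inside K' K, rec K' h).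
exists (Fix wf (fun=> Prop) G) => K; rewrite Fix_eq => [|{}K V V' VV'].
  have E K' : inside K' K -> (exists _ : inside K' K, Fix wf (fun=> Prop) G K') <->
      Fix wf (fun=> Prop) G K'.
    by move=> inK'; split=> [[] //|VK']; exists inK'.
  by split; apply: locF => K' /E [].
congr (F K _); apply: funext => K'; apply: propext.
by split=> -[h Vh]; exists h; [rewrite -VV'|rewrite VV'].
Qed.

Section FiniteState.

Variables (Psi : form) (Y : nat).
Hypothesis qPsi : quantifier_free Psi.

(* [Y] is added so that types record it even when it does not occur in [Psi];
   removing duplicates makes a type determined by the formulas it holds. *)
Let Subs := undup (Var Y :: subforms Psi).
Let X := [seq x <- free_vars Psi | x != Y].

Lemma Subs_args A B :
  [|| And A B \in Subs, Or A B \in Subs | Imp A B \in Subs] -> A \in Subs /\ B \in Subs.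
Proof.
by rewrite !mem_undup !inE /= => /subforms_args[-> ->]; rewrite !orbT.
Qed.

Lemma Subs_qf A : A \in Subs -> quantifier_free A.
Proof.
rewrite mem_undup inE => /orP[/eqP -> //|H]; exact: subforms_qf H qPsi.
Qed.

Lemma Subs_Y : Var Y \in Subs. Proof. by rewrite mem_undup mem_head. Qed.

Lemma Subs_X x : x \in X -> Var x \in Subs.
Proof.
by rewrite mem_filter mem_undup inE subforms_var // => /andP[_ ->]; rewrite orbT.
Qed.

Lemma Subs_var x : Var x \in Subs -> x = Y \/ x \in X.
Proof.
rewrite mem_undup inE subforms_var // mem_filter => /orP[/eqP[]|->]; first by left.
by case: eqP; [left|right].
Qed.

Definition ptype : finType := (size Subs).-tuple bool.

Definition holds (t : ptype) (A : form) : bool := nth false t (index A Subs).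

Definition mktype (p : form -> bool) : ptype := map_tuple p (in_tuple Subs).

Lemma holds_mktype p A : A \in Subs -> holds (mktype p) A = p A.
Proof.
by move=> AS; rewrite /holds /= (nth_map A) ?index_mem // nth_index.
Qed.

Lemma type_ext t u : {in Subs, holds t =1 holds u} -> t = u.
Proof.
move=> tu; apply: val_inj; apply: (@eq_from_nth _ false).
  by rewrite !size_tuple.
move=> i; rewrite size_tuple => iS.
have := tu _ (mem_nth (Var Y) iS); rewrite /holds index_uniq //; exact: undup_uniq.
Qed.

Definition le_type (t u : ptype) : Prop := {in Subs, forall A, holds t A -> holds u A}.

Lemma le_type_anti t u : le_type t u -> le_type u t -> t = u.
Proof.
by move=> tu ut; apply: type_ext => A AS; apply/idP/idP; [apply: tu|apply: ut].
Qed.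

Definition lits (t : ptype) : seq nat := [seq x <- X | holds t (Var x)].

Definition bottom (T : {set ptype}) (t : ptype) : Prop :=
  t \in T /\ {in T, forall u, le_type t u}.

Lemma bottom_uniq T t u : bottom T t -> bottom T u -> t = u.
Proof. by move=> [tT Tt] [uT Tu]; apply: le_type_anti; [apply: Tt|apply: Tu]. Qed.

Definition with_Y (V : tree -> Prop) (k : nat) : tree -> Prop :=
  if k == Y then V else holds_var k.

Definition typ (V : tree -> Prop) (K : tree) : ptype :=
  mktype (fun A => `[< force reach (with_Y V) A K >]).

Definition types V K : {set ptype} :=
  [set t | `[< exists2 K', reach K K' & typ V K' = t >]].

Definition above V cs : {set ptype} :=
  [set t | `[< exists c K', [/\ List.In c cs, reach c K' & typ V K' = t] >]].

Lemma typP V K A : A \in Subs -> holds (typ V K) A <-> force reach (with_Y V) A K.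
Proof. by move=> AS; rewrite holds_mktype //; split=> /asboolP. Qed.

Lemma typ_Y V K : holds (typ V K) (Var Y) <-> V K.
Proof. by rewrite typP ?Subs_Y //= /with_Y eqxx. Qed.

Lemma typ_X V K x : x \in X -> holds (typ V K) (Var x) <-> holds_var x K.
Proof.
move=> xX; rewrite typP ?Subs_X //= /with_Y.
by move: xX; rewrite mem_filter => /andP[/negPf ->].
Qed.

Lemma eq_lits V K V' K' :
  (forall x, x \in X -> holds_var x K <-> holds_var x K') <->
  lits (typ V K) = lits (typ V' K').
Proof.
split=> [H|H x xX]; last first.
  rewrite -(typ_X V) // -(typ_X V') //.
  by have := congr1 (fun l => x \in l) H; rewrite !(mem_filter _ _ X) xX !andbT => ->.
by apply: eq_in_filter => x xX; apply/idP/idP; rewrite !typ_X // H.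
Qed.

Lemma typesP V K t : reflect (exists2 K', reach K K' & typ V K' = t) (t \in types V K).
Proof. by rewrite inE; apply: asboolP. Qed.

Lemma aboveP V cs t :
  reflect (exists c K', [/\ List.In c cs, reach c K' & typ V K' = t]) (t \in above V cs).
Proof. by rewrite inE; apply: asboolP. Qed.

Lemma typ_in_types V K K' : reach K K' -> typ V K' \in types V K.
Proof. by move=> KK'; apply/typesP; exists K'. Qed.

Lemma types_Node V v cs :
  types V (Node v cs) = typ V (Node v cs) |: above V cs.
Proof.
apply/setP => t; rewrite in_setU1; apply/typesP/orP.
  move=> [K' /reach_Node[->|[c ccs cK']] Et]; first by left; rewrite Et.
  by right; apply/aboveP; exists c, K'.
move=> [/eqP ->|/aboveP[c [K' [ccs cK' Et]]]]; last by exists K' => //; apply: reach_child cK'.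
by exists (Node v cs) => //; apply: reach_refl.
Qed.

Lemma types_reach V K K' : reach K K' -> types V K' \subset types V K.
Proof.
move=> KK'; apply/subsetP => t /typesP[K'' K'K'' <-].
by apply: typ_in_types; apply: reach_trans K'K''.
Qed.

Lemma eq_force_inside V V' A K : quantifier_free A ->
  (forall K', reach K K' -> V K' <-> V' K') ->
  force reach (with_Y V) A K <-> force reach (with_Y V') A K.
Proof.
elim: A K => //= [k K _ VV'|A IHA B IHB|A IHA B IHB|A IHA B IHB].
  by rewrite /with_Y; case: eqP => // _; apply: VV'; apply: reach_refl.
- by move=> K /andP[qA qB] VV'; rewrite IHA ?IHB.
- by move=> K /andP[qA qB] VV'; rewrite IHA ?IHB.
move=> K /andP[qA qB] VV'.
have HK K' : reach K K' -> forall K'', reach K' K'' -> V K'' <-> V' K''.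
  by move=> KK' K'' K'K''; apply: VV'; apply: reach_trans K'K''.
by split=> H K' KK'; move: (H K' KK'); rewrite (IHA _ qA (HK _ KK')) (IHB _ qB (HK _ KK')).
Qed.

Lemma eq_typ V V' K :
  (forall K', reach K K' -> V K' <-> V' K') -> typ V K = typ V' K.
Proof.
move=> VV'; apply: type_ext => A AS; apply/idP/idP; rewrite !typP //.
  by rewrite (eq_force_inside _ VV') ?Subs_qf.
by rewrite (eq_force_inside _ VV') ?Subs_qf.
Qed.

Lemma eq_above V V' v cs :
  (forall K', inside K' (Node v cs) -> V K' <-> V' K') -> above V cs = above V' cs.
Proof.
move=> VV'; apply/setP => t.
have E c K' : List.In c cs -> reach c K' -> typ V K' = typ V' K'.
  move=> ccs cK'; apply: eq_typ => K'' K'K''; apply: VV'; exists c => //.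
  exact: reach_trans K'K''.
by apply/aboveP/aboveP => -[c [K' [ccs cK' <-]]]; exists c, K'; rewrite (E c).
Qed.

Lemma typ_reach V K K' : upset reach V -> reach K K' -> le_type (typ V K) (typ V K').
Proof.
move=> uV KK' A AS; rewrite !typP //; apply: upset_force KK'; first exact: reach_trans.
by move=> k; rewrite /with_Y; case: eqP => // _; apply: upset_holds_var.
Qed.

Lemma typ_bottom V K t : upset reach V -> t \in types V K -> le_type (typ V K) t.
Proof. by move=> uV /typesP[K' KK' <-]; apply: typ_reach. Qed.

Lemma force_Imp_Node V v cs A B : A \in Subs -> B \in Subs ->
  force reach (with_Y V) (Imp A B) (Node v cs) <->
  (force reach (with_Y V) A (Node v cs) -> force reach (with_Y V) B (Node v cs)) /\
  {in above V cs, forall u, holds u A -> holds u B}.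
Proof.
move=> AS BS; split=> /= [H|[H0 H] K' /reach_Node[-> //|[c ccs cK']]].
  split; first by apply: H; exact: reach_refl.
  move=> _ /aboveP[c [K' [ccs cK' <-]]]; rewrite !typP //.
  by apply: H; apply: reach_child cK'.
by rewrite -!typP //; apply: H; apply/aboveP; exists c, K'.
Qed.

(** Forcing of an implication looks at the root and at the types strictly above
    it, so the type of a node is a function of its variables, its [Y] and these
    types. *)
Lemma typ_determined V v cs V' v' cs' : above V cs = above V' cs' ->
  lits (typ V (Node v cs)) = lits (typ V' (Node v' cs')) ->
  (V (Node v cs) <-> V' (Node v' cs')) -> typ V (Node v cs) = typ V' (Node v' cs').
Proof.
move=> Eabove /eq_lits Elits EY; apply: type_ext => A AS.
suff {A AS} H A : A \in Subs -> force reach (with_Y V) A (Node v cs) <->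
    force reach (with_Y V') A (Node v' cs').
  by apply/idP/idP; rewrite !typP // H.
elim: A => [k||A IHA B IHB|A IHA B IHB|A IHA B IHB|A _|A _] AS;
  try (by have := Subs_qf AS).
- case: (Subs_var AS) => [->|kX]; first by rewrite /= /with_Y eqxx.
  by rewrite -!typP ?typ_X ?Subs_X //; apply: Elits.
- have [|AS' BS'] := @Subs_args A B; first by rewrite AS ?orbT.
  by rewrite /= IHA // IHB.
- have [|AS' BS'] := @Subs_args A B; first by rewrite AS ?orbT.
  by rewrite /= IHA // IHB.
have [|AS' BS'] := @Subs_args A B; first by rewrite AS !orbT.
by rewrite !force_Imp_Node // Eabove IHA // IHB.
Qed.

(** A node with the variables and [Y] of a least type [u] above it adds nothing:
    an implication forced by [u] is forced by all types above the node. *)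
Lemma typ_stutter V v cs u : upset reach V -> bottom (above V cs) u ->
  lits u = lits (typ V (Node v cs)) -> (V (Node v cs) <-> holds u (Var Y)) ->
  typ V (Node v cs) = u.
Proof.
move=> uV [/aboveP[c [K' [ccs cK' <-]]] minu] /eq_lits Elits EY.
have KK' : reach (Node v cs) K' by apply: reach_child cK'.
apply: le_type_anti; first exact: typ_reach.
move=> A AS; rewrite !typP //; move: A AS.
suff H A : A \in Subs -> force reach (with_Y V) A (Node v cs) <->
    force reach (with_Y V) A K' by move=> A /H[].
elim: A => [k||A IHA B IHB|A IHA B IHB|A IHA B IHB|A _|A _] AS;
  try (by have := Subs_qf AS).
- case: (Subs_var AS) => [->|kX]; first by rewrite /= /with_Y eqxx EY typ_Y.
  by rewrite -!typP ?typ_X ?Subs_X //; apply: iff_sym; apply: Elits.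
- have [|AS' BS'] := @Subs_args A B; first by rewrite AS ?orbT.
  by rewrite /= IHA // IHB.
- have [|AS' BS'] := @Subs_args A B; first by rewrite AS ?orbT.
  by rewrite /= IHA // IHB.
have [|AS' BS'] := @Subs_args A B; first by rewrite AS !orbT.
split=> [|H]; first by move=> H K'' /(reach_trans KK'); apply: H.
apply/force_Imp_Node => //; split=> [/IHA HA|w wabove HA].
  by apply/IHB => //; apply: H (reach_refl _) (HA _).
move: wabove HA => wabove; have /(_ (Imp A B) AS) := minu _ wabove.
rewrite [holds (typ V K') _ : Prop]typP // => /(_ H).
move/aboveP: wabove => [d [K'' [_ _ <-]]]; rewrite !typP // => H' HA.
by apply: H' (reach_refl _) HA.
Qed.

Variable U : tree -> Prop.
Hypothesis uU : upset reach U.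
Hypothesis solU : forall K, force reach (with_Y U) Psi K.

(** The bottom-up rule deciding [Y] at a node with variables [r] and types [T]
    strictly above it.  If [T] has a least type with variables [r], that type is
    repeated; otherwise [Y] is set as soon as [U] sets it at some node in the same
    situation.  If no such node sets [Y], then all of them leave it unset; so in
    a situation that occurs under [U] the choice agrees with [U] somewhere. *)
Definition prescribed (r : seq nat) (T : {set ptype}) : Prop :=
  (exists t, [/\ bottom T t, lits t = r & holds t (Var Y)]) \/
  (~ exists t, bottom T t /\ lits t = r) /\
  exists v cs, [/\ above U cs = T, lits (typ U (Node v cs)) = r & U (Node v cs)].

Definition prescribed_solution (V : tree -> Prop) : Prop :=
  forall v cs,
    V (Node v cs) <-> prescribed (lits (typ V (Node v cs))) (above V cs).

Lemma prescribed_solution_exists : exists V, prescribed_solution V.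
Proof.
have [|V HV] := @tree_recursion (fun K V =>
    let: Node v cs := K in prescribed (lits (typ V K)) (above V cs)).
  move=> [v cs] V V' VV'.
  rewrite (eq_above VV'); suff -> : lits (typ V (Node v cs)) = lits (typ V' (Node v cs)) by [].
  exact/eq_lits.
by exists V => v cs; apply: HV.
Qed.

Variable V : tree -> Prop.
Hypothesis solV : prescribed_solution V.

Lemma upset_prescribed : upset reach V.
Proof.
move=> K K' KK'; case: KK' => // v cs c {}K' ccs cK' /solV VK.
apply/typ_Y; have : typ V K' \in above V cs by apply/aboveP; exists c, K'.
move: (above V cs) VK => T [[t [[_ minT] _ tY]] /minT ut|[_ [v0 [cs0 [<- _ UK]]]]].
  by apply: ut; rewrite ?Subs_Y.
move=> /aboveP[c0 [K0 [c0cs cK0 <-]]]; apply/typ_Y; apply: uU UK.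
exact: reach_child cK0.
Qed.

Let uV := upset_prescribed.

Lemma typ_prescribed_stutter v cs u : bottom (above V cs) u ->
  lits u = lits (typ V (Node v cs)) -> typ V (Node v cs) = u.
Proof.
move=> bu Eu; apply: typ_stutter => //; rewrite solV; split=> [[[t [bt _ tY]]|[no _]]|uY].
- by rewrite (bottom_uniq bu bt).
- by case: no; exists u.
- by left; exists u.
Qed.

Lemma typ_prescribed_determined v cs v' cs' : above V cs = above V cs' ->
  lits (typ V (Node v cs)) = lits (typ V (Node v' cs')) ->
  typ V (Node v cs) = typ V (Node v' cs').
Proof. by move=> E1 E2; apply: typ_determined => //; rewrite !solV E1 E2. Qed.

(** The variables of a node are its label intersected with those of the types
    above it, independently of how these are realised. *)
Lemma lits_Node V1 V2 v cs ds : above V1 cs = above V2 ds ->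
  lits (typ V1 (Node v cs)) = lits (typ V2 (Node v ds)).
Proof.
have half W1 W2 cs1 cs2 x : x \in X -> above W1 cs1 = above W2 cs2 ->
    holds_var x (Node v cs1) -> holds_var x (Node v cs2).
  move=> xX E /holds_var_Node[xv H]; apply/holds_var_Node; split=> // c ccs.
  have : typ W2 c \in above W2 cs2 by apply/aboveP; exists c, c; split=> //; apply: reach_refl.
  rewrite -E => /aboveP[d [K [dcs dK /esym EK]]].
  by apply/(typ_X W2) => //; rewrite EK; apply/typ_X => //;
    apply: upset_holds_var dK (H d dcs).
by move=> E; apply/eq_lits => x xX; split; [exact: half E|exact: half (esym E)].
Qed.

(** The whole set of types in a tree under [V] has to be realised under [U] at
    once, so that the induction can rebuild a node with the same types above it.
    A forest rather than a tree realises it: when the root repeats a type that is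
    already there, a tree under [U] with the same proper subtrees could get a
    new type at its root. *)
Lemma types_realised K : exists cs, types V K = above U cs.
Proof.
elim/tree_ind_in: K => v cs IH.
have [ds Eds] : exists ds, above V cs = above U ds.
  elim: cs IH => [|c cs IHcs] IH.
    by exists [::]; apply/setP => t; apply/aboveP/aboveP => -[? [? []]].
  have [|ds Eds] := IHcs; first by move=> d dcs; apply: IH; right.
  have [es Ees] : exists es, types V c = above U es by apply: IH; left.
  have cat W l1 l2 : above W (l1 ++ l2) = above W l1 :|: above W l2.
    apply/setP => t; rewrite in_setU; apply/aboveP/orP.
      move=> [d [K [/List.in_app_iff[?|?] dK Et]]]; [left|right];
      by apply/aboveP; exists d, K.
    by move=> [|] /aboveP[d [K [dl dK Et]]]; exists d, K; split=> //;
      apply/List.in_app_iff; [left|right].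
  have one W d : above W [:: d] = types W d.
    apply/setP => t; apply/aboveP/typesP => [[_ [K [[<-|//] dK Et]]]|[K dK Et]].
      by exists K.
    by exists d, K; split=> //; left.
  by exists (es ++ ds); rewrite -cat1s !cat one Eds Ees.
have [[t [bt Et]]|no] := lem (exists t, bottom (above V cs) t /\
    lits t = lits (typ V (Node v cs))).
  exists ds; rewrite types_Node (typ_prescribed_stutter bt Et) -Eds.
  by apply/setUidPr; rewrite sub1set; case: bt.
pose r := lits (typ V (Node v cs)).
have [v1 [cs1 [Ecs1 Er UV]]] : exists v1 cs1, [/\ above U cs1 = above V cs,
    lits (typ U (Node v1 cs1)) = r & U (Node v1 cs1) <-> V (Node v cs)].
  have [VK|VK] := lem (V (Node v cs)).
    have [[t [bt Et _]]|[_ [v1 [cs1 [E1 E2 E3]]]]] := (solV v cs).1 VK.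
      by case: no; exists t.
    by exists v1, cs1.
  exists v, ds; split=> //; first by apply: lits_Node; rewrite Eds.
  split=> // UK; case: VK; apply/solV; right; split=> //.
  by exists v, ds; split=> //; apply: lits_Node; rewrite Eds.
exists [:: Node v1 cs1].
have -> : above U [:: Node v1 cs1] = types U (Node v1 cs1).
  apply/setP => t; apply/aboveP/typesP => [[_ [K [[<-|//] dK Et]]]|[K dK Et]].
    by exists K.
  by exists (Node v1 cs1), K; split=> //; left.
rewrite !types_Node Ecs1; congr (_ |: _).
by apply: typ_determined => //; rewrite UV.
Qed.

Lemma prescribed_solves K : force reach (with_Y V) Psi K.
Proof.
have PS : Psi \in Subs by rewrite mem_undup inE subforms_refl orbT.
have [cs E] := types_realised K.
have : typ V K \in types V K by apply: typ_in_types; apply: reach_refl.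
rewrite E => /aboveP[c [K' [_ _ E']]].
by apply/typP => //; rewrite -E'; apply/typP.
Qed.

(** A node of another type than the root's has lost the root's type, since types
    only grow along the order. *)
Lemma types_proper K z u : reach K z -> typ V z = u -> u <> typ V K ->
  #|types V z| < #|types V K|.
Proof.
move=> Kz Ez uK; apply: proper_card; rewrite properE types_reach //=.
apply/negP => /subsetP/(_ _ (typ_in_types V (reach_refl K))) /(typ_bottom uV) H.
by apply: uK; rewrite -Ez; apply: le_type_anti H _; apply: typ_reach.
Qed.

Lemma types_neq_proper K z : reach K z -> types V z <> types V K ->
  #|types V z| < #|types V K|.
Proof.
move=> Kz zK; rewrite ltnNge; apply/negP => H; apply: zK.
by apply/eqP; rewrite eqEcard types_reach.
Qed.

Lemma bottom_types K : bottom (types V K) (typ V K).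
Proof.
split; first by apply: typ_in_types; apply: reach_refl.
by move=> u; apply: typ_bottom.
Qed.

Lemma above_sub v cs : above V cs \subset types V (Node v cs).
Proof. by rewrite types_Node subsetUr. Qed.

Lemma agree_lits N K K' : agree X N K K' -> lits (typ V K) = lits (typ V K').
Proof. by move=> H; apply/eq_lits => x; apply: agree_var H. Qed.

(** Induction on the number of types in [K].  Let [t] be the type of [K].  Nodes
    above [K] whose set of types is smaller are matched in [K'] by nodes of the
    same type, by induction.  A topmost node of [K'] with a type foreign to [K]
    can only be matched by a node [y] carrying all types of [K]; then the types
    strictly above it are those of [K] with or without [t].  With [t], the
    repetition rule gives it type [t]; without [t], it is in the same situation
    as a topmost node of type [t] above [y], and gets type [t] again.  So [K']
    has only types of [K].  By a similar argument [t] occurs in [K'], and the two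
    roots, being least in their sets of types, have the same type.  Each step of
    the induction matches twice, whence the bound [s.*2]. *)
Lemma typ_agree s K K' : #|types V K| <= s -> agree X s.*2 K K' ->
  typ V K = typ V K'.
Proof.
elim: s K K' => [|s IH] K K'.
  rewrite leqn0 cards_eq0 => /eqP E.
  by have := typ_in_types V (reach_refl K); rewrite E inE.
move=> cardK; rewrite doubleS => agr; set t := typ V K.
have tK : t \in types V K by apply: typ_in_types; apply: reach_refl.
have transfer y y' z : reach K y -> agree X s.*2.+1 y y' -> reach y z ->
    #|types V z| < #|types V K| -> exists2 z', reach y' z' & typ V z' = typ V z.
  move=> Ky yy' yz cardz; have [z' y'z' zz'] := match_above_agree yy' yz.
  exists z' => //; apply: esym; apply: IH zz'.
  by rewrite -ltnS; apply: leq_trans cardK.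
have typ_eq y : types V y = types V K -> typ V y = t.
  move=> Ey; apply: (@bottom_uniq (types V K)); last exact: bottom_types.
  by rewrite -Ey; apply: bottom_types.
(* Every type of [K] other than [t] occurs above [y] at a node where induction
   applies. *)
have typeK y u : types V y = types V K -> u \in types V K -> u <> t ->
    exists z, [/\ reach y z, typ V z = u & #|types V z| < #|types V K|].
  move=> Ey uK ut; move: (uK); rewrite -Ey => /typesP[z yz zu].
  exists z; split=> //; apply: types_proper yz zu _.
  by rewrite typ_eq.
(* A topmost node of type [t] above [y]: either induction applies to it, or all
   types of [K] other than [t] lie strictly above it. *)
have first_t y : types V y = types V K -> exists v cs,
   [/\ reach y (Node v cs), typ V (Node v cs) = t, above V cs \subset types V K :\ t
     & #|types V (Node v cs)| < #|types V K| \/ above V cs = types V K :\ t].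
  move=> Ey; have /typesP[x yx xt] : t \in types V y by rewrite Ey.
  have [v [cs [ycs tcs top]]] := @topmost (fun z => typ V z = t) _ _ yx xt.
  have sub : above V cs \subset types V K :\ t.
    apply/subsetP => u uab; rewrite in_setD1; apply/andP; split.
      apply/eqP => ut; move: uab => /aboveP[c [K1 [ccs cK1 E1]]].
      by apply: (top c K1 ccs cK1); rewrite E1.
    rewrite -Ey; apply: (subsetP (types_reach V ycs)).
    exact: (subsetP (above_sub v cs)).
  exists v, cs; split=> //.
  have [E|NE] := eqVneq (types V (Node v cs)) (types V K); [right|left].
    apply/eqP; rewrite eqEsubset sub /= -E types_Node tcs setU1K //.
    by apply/negP => /(subsetP sub); rewrite !inE eqxx.
  by rewrite -Ey; apply: types_neq_proper => // H; move: NE; rewrite H Ey eqxx.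
(* A node matching a node of [K] with no ptype outside [types V K] at or above it
   carries all types of [K] other than [t]. *)
have others y y' : reach K y -> types V y = types V K -> agree X s.*2.+1 y y' ->
    types V K :\ t \subset types V y'.
  move=> Ky Ey yy'; apply/subsetP => u; rewrite in_setD1 => /andP[/eqP ut uK].
  have [z [yz <- cardz]] := typeK y u Ey uK ut.
  have [z' y'z' <-] := transfer y y' z Ky yy' yz cardz.
  exact: typ_in_types.
have noBad : types V K' \subset types V K.
  apply/subsetP => u0 /typesP[K0 K'K0 E0]; apply: contrapT => bad0.
  have [v' [cs' [K'y' bad top]]] : exists v cs, [/\ reach K' (Node v cs),
      typ V (Node v cs) \notin types V K
      & forall c K1, List.In c cs -> reach c K1 -> ~ (typ V K1 \notin types V K)].
    by apply: topmost K'K0 _; rewrite E0; apply/negP.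
  have aboveK : above V cs' \subset types V K.
    apply/subsetP => _ /aboveP[c [K1 [ccs cK1 <-]]].
    exact/negPn/negP/(top c K1).
  set y' := Node v' cs' in K'y' bad.
  have [y Ky /agree_sym yy'] := match_above_agree (agree_sym agr) K'y'.
  have Ey : types V y = types V K.
    apply: contrapT => /(types_neq_proper Ky) cardy.
    move/negP: bad; apply; rewrite -(IH y y'); last exact: agree_pred.
      exact: typ_in_types.
    by rewrite -ltnS; apply: leq_trans cardK.
  have Elits : lits t = lits (typ V y') by rewrite -(typ_eq y Ey); apply: agree_lits yy'.
  have bad_t : typ V y' <> t by move=> E; rewrite E tK in bad.
  have sub1 : types V K :\ t \subset above V cs'.
    apply/subsetP => u ut; have := subsetP (others y y' Ky Ey yy') u ut.
    rewrite types_Node in_setU1 => /orP[/eqP uy'|//].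
    by move: ut bad; rewrite uy' in_setD1 => /andP[_ ->].
  have tabove : t \notin above V cs'.
    apply/negP => tabove; apply: bad_t; apply: typ_prescribed_stutter => //.
    have -> : above V cs' = types V K; last exact: bottom_types.
    by apply/eqP; rewrite eqEsubset aboveK -(setD1K tK) subUset sub1set tabove.
  have Eabove : above V cs' = types V K :\ t.
    by apply/eqP; rewrite eqEsubset sub1 subsetD1 aboveK tabove.
  have [v [cs [yx tx _ [small|Ex]]]] := first_t y Ey.
    have [x' y'x'] := transfer y y' _ Ky yy' yx small; rewrite tx => tx'.
    have := typ_in_types V y'x'; rewrite tx' types_Node in_setU1 (negPf tabove) orbF.
    by move=> /eqP E; apply: bad_t; rewrite E.
  by apply: bad_t; rewrite -tx; apply: typ_prescribed_determined;
    rewrite ?Ex ?Eabove // tx -Elits.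
(* Otherwise a topmost node of type [t] in [K] has exactly the types of [K'] above
   it, with a least one of the same variables, and would repeat it. *)
have tK' : t \in types V K'.
  apply/negPn/negP => tK'.
  have EK' : types V K' = types V K :\ t.
    apply/eqP; rewrite eqEsubset subsetD1 noBad tK' /=.
    by apply: others (reach_refl K) _ (agree_pred agr).
  have [v [cs [Kx tx _ [small|Ex]]]] := first_t K erefl.
    have [x' K'x'] := transfer K K' _ (reach_refl K) (agree_pred agr) Kx small.
    by rewrite tx => tx'; move/negP: tK'; apply; rewrite -tx'; apply: typ_in_types.
  move/negP: tK'; apply; rewrite -tx (@typ_prescribed_stutter _ _ (typ V K')).
  - by apply: typ_in_types; apply: reach_refl.
  - by rewrite Ex -EK'; apply: bottom_types.
  - by rewrite tx /t (agree_lits agr).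
apply: le_type_anti; last exact: typ_bottom.
apply: typ_bottom => //; apply: (subsetP noBad).
by apply: typ_in_types; apply: reach_refl.
Qed.

End FiniteState.

Theorem definable_solution Psi Y (U : tree -> Prop) : quantifier_free Psi ->
  upset reach U -> (forall K, force reach (with_Y Y U) Psi K) ->
  exists2 A, quantifier_free A & forall K, force reach (with_Y Y (tforce A)) Psi K.
Proof.
move=> qPsi uU solU.
have [V solV] := @prescribed_solution_exists Psi Y qPsi U.
have uV := upset_prescribed uU solV.
pose X := [seq x <- free_vars Psi | x != Y].
pose N := #|ptype Psi Y|.*2.
have [K K' agr VK|A qA HA] := @definable_upset X N V uV.
  apply/(@typ_Y Psi Y); rewrite -(typ_agree qPsi uU solV (max_card _) agr).
  exact/typ_Y.
exists A => // K.
have -> : tforce A = V by apply: funext => K1; apply: propext.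
exact (prescribed_solves qPsi uU solU solV K).
Qed.

Lemma quantifier_free_subst s A : quantifier_free A ->
  (forall k, quantifier_free (s k)) -> quantifier_free (subst s A).
Proof.
by elim: A => //= A IHA B IHB /andP[qA qB] qs; rewrite IHA ?IHB.
Qed.

(** Quantifiers do not help to solve an equation [⊢ Psi(Y)] of intuitionistic
    propositional logic, whose other variables act as parameters. *)
Theorem quantifier_free_solution Y Psi phi : quantifier_free Psi ->
  [::] ⊢ subst_var Y phi Psi ->
  exists2 A, quantifier_free A & [::] ⊢ subst_var Y A Psi.
Proof.
move=> qPsi H.
have force_subst_var B : tforce (subst_var Y B Psi) = force reach (with_Y Y (tforce B)) Psi.
  rewrite /subst_var force_subst; congr force; apply: funext => k /=.
  by rewrite /with_Y; case: eqP.
have [|K|A qA HA] := @definable_solution Psi Y (tforce phi) qPsi.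
- exact: upset_tforce.
- rewrite -force_subst_var.
  exact: (force_sound reach_refl reach_trans H upset_holds_var).
exists A => //; apply: tree_complete => [|K]; last by rewrite force_subst_var.
by apply: quantifier_free_subst => // k; case: eqP.
Qed.

(** * The three statements *)

Theorem theorem2p11 (n : nat) (X : n.-tuple nat) (Y : nat) (Phi E : form)
    (X_distinct : uniq X) (Y_notin_X : Y \notin X)
    (Phi_over : prop_form_over (Y :: X) Phi)
    (E_interpolant : pitts_interpolant X Phi E) :
  [/\ (exists phi : form, auxiliary Y Phi E phi) ->
        definable X (ex_var Y Phi),
      (exists D : form,
          [/\ quantifier_free D, or_free D & equivalent E D]) ->
        [:: E] ⊢ ex_var Y Phi ->
        exists phi : form, auxiliary Y Phi E phi
    & (exists phi : form, auxiliary Y Phi E phi) ->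
        exists phi : form, quantifier_free phi /\ auxiliary Y Phi E phi].
Proof.
case: E_interpolant => -[qE EX] adjE; have [qPhi _] := Phi_over.
have YE : Y \notin free_vars E by apply: contra Y_notin_X; apply: EX.
have PhiE : [:: Phi] ⊢ E by apply/adjE => //; apply: Ax.
have substE B : subst_var Y B E = E.
  rewrite -[RHS](subst_id E (frefl Var)); apply: eq_subst_qf => // k kE.
  by case: eqP => // kY; rewrite kY in kE; rewrite kE in YE.
split.
- move=> [phi aux]; exists E; split=> //; split; first exact: ex_var_elim.
  exact: ex_var_intro aux.
- by move=> [D [qD oD ED]]; apply: or_free_witness ED.
move=> [phi aux]; have [||A qA HA] := @quantifier_free_solution Y (Imp E Phi) phi.
- by rewrite /= qE.
- by rewrite /subst_var /= -!/(subst_var _ _ _) substE; apply: ImpR.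
exists A; split=> //; move: HA.
rewrite /subst_var /= -!/(subst_var _ _ _) substE => HA.
by apply: (@derivable_mp _ E); [apply: Weakening|apply: Ax].
Qed.
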